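(* Fix observed values $\mathbf{z}_1,\dots,\mathbf{z}_K\in\mathbb{R}^{\alpha}$ of $\mathbf{Z}_1,\dots,\mathbf{Z}_K$ and a current parameter estimate $\hat{\boldsymbol\theta}^{(m)}$. In the EM algorithm the next estimate $\hat{\boldsymbol\theta}^{(m+1)}$ is determined by the maximization step $$\frac{dT^{(m+1)}}{d\theta_t}=E\left[\sum_{k=1}^K\frac{R_k-G_k}{\sigma_k^2}\,\frac{dG_k}{d\theta_t}\;\middle|\;\mathbf{Z},\hat{\boldsymbol\theta}^{(m)}\right]\Bigg|_{\boldsymbol\theta=\hat{\boldsymbol\theta}^{(m+1)}}=0,\qquad t=1,\dots,L,$$ where $T^{(m+1)}=E\left[-\frac12\sum_{k=1}^K\frac{(R_k-G_k)^2}{\sigma_k^2}\,\middle|\,\mathbf{Z},\hat{\boldsymbol\theta}^{(m)}\right]$ is the conditional expectation (under parameter value $\hat{\boldsymbol\theta}^{(m)}$, given $\mathbf{Z}_k=\mathbf{z}_k$ for all $k$) of the complete-data log-likelihood, up to terms not depending on $\boldsymbol\theta$. Then the expression for the iterative evaluation of the unknown parameters can be written as $$\sum_{k=1}^K\frac{dG_k^{(m+1)}}{d\theta_t}\,A(G_k^{(m)})-\sum_{k=1}^K G_k^{(m+1)}\frac{dG_k^{(m+1)}}{d\theta_t}\,B(G_k^{(m)})=0,\qquad t=1,\dots,L,$$ where $$A(G_k^{(m)})=\sum_{j=1}^M\frac{\exp\left(-\frac{(\mathbf{z}_k-\mathbf{b}_j)^T(\mathbf{z}_k-\mathbf{b}_j)}{2\eta_k^2}\right)}{f^{(m)}_{\mathbf{Z}_k}(\mathbf{z}_k)\,(2\pi\eta_k^2)^{\alpha/2}}\left(\sqrt{\tfrac{\sigma_k^2}{2\pi}}\,e^{-\frac{(\tau_j-G_k^{(m)})^2}{2\sigma_k^2}}-\sqrt{\tfrac{\sigma_k^2}{2\pi}}\,e^{-\frac{(\tau_{j+1}-G_k^{(m)})^2}{2\sigma_k^2}}+G_k^{(m)}\,\Delta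 T^{(m)}(j,k)\right),$$ $$B(G_k^{(m)})=\sum_{j=1}^M\frac{\exp\left(-\frac{(\mathbf{z}_k-\mathbf{b}_j)^T(\mathbf{z}_k-\mathbf{b}_j)}{2\eta_k^2}\right)}{f^{(m)}_{\mathbf{Z}_k}(\mathbf{z}_k)\,(2\pi\eta_k^2)^{\alpha/2}}\,\Delta T^{(m)}(j,k),$$ with $$\Delta T^{(m)}(j,k)=Q\left(\frac{\tau_j-G_k^{(m)}}{\sigma_k}\right)-Q\left(\frac{\tau_{j+1}-G_k^{(m)}}{\sigma_k}\right),\qquad f^{(m)}_{\mathbf{Z}_k}(\mathbf{z}_k)=\int f^{(m)}_{\mathbf{Z}_k|R_k}(\mathbf{z}_k|r)\,f^{(m)}_{R_k}(r)\,dr,$$ and $Q(x)=\frac{1}{\sqrt{2\pi}}\int_x^\infty \exp(-t^2/2)\,dt$.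
   Context: Model. $K,L\ge1$ are integers, $M=2^{\alpha}$ with $\alpha=\log_2 M\ge1$ an integer. $\boldsymbol\Theta\subset\mathbb{R}^L$ is the set of admissible parameters $\boldsymbol\theta=(\theta_1,\dots,\theta_L)^T$. $G(x,y:\boldsymbol\theta)$ is a real-valued deterministic parametric field, differentiable in $\boldsymbol\theta$; sensors sit at known locations $(x_k,y_k)$, and $G_k=G(x_k,y_k:\boldsymbol\theta)$, $k=1,\dots,K$. Sensor $k$ observes $R_k=G_k+W_k$ with $W_k\sim\mathcal{N}(0,\sigma_k^2)$, $\sigma_k>0$ known. Quantizer: boundaries $-\infty=\tau_1<\tau_2<\dots<\tau_M<\tau_{M+1}=+\infty$. The $j$-th quantization region, between $\tau_j$ and $\tau_{j+1}$, is labelled by a vector $\mathbf{b}_j$ of $\alpha$ bits (the binary representation of the $j$-th level), distinct for distinct $j$. Sensor $k$ sends $\mathbf{B}_k=\mathbf{b}_j$ when $R_k$ lies in the $j$-th region. The fusion center receives $\mathbf{Z}_k=\mathbf{B}_k+\mathbf{N}_k$, where $\mathbf{N}_k\sim\mathcal{N}(\mathbf{0},\eta_k^2 I_\alpha)$, $\eta_k>0$ known. All $W_1,\dots,W_K,\mathbf{N}_1,\dots,\mathbf{N}_K$ are mutually independent. In the EM formulation the pairs $(R_k,\mathbf{N}_k)$ are the complete data and the $\mathbf{Z}_k$ are the incomplete data; $\mathbf{Z}=(\mathbf{Z}_1,\dots,\mathbf{Z}_K)$. Notation: $G_k^{(m)}$ is $G_k$ with $\boldsymbol\theta$ replaced by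 the $m$-th iterate $\hat{\boldsymbol\theta}^{(m)}$; $G_k^{(m+1)}$ and $\frac{dG_k^{(m+1)}}{d\theta_t}$ are $G_k$ and $\frac{\partial G_k}{\partial\theta_t}$ evaluated at $\hat{\boldsymbol\theta}^{(m+1)}$. $f^{(m)}_{\mathbf{Z}_k|R_k}(\cdot|r)$ is the conditional density of $\mathbf{Z}_k$ given $R_k=r$, i.e. the $\mathcal{N}(\mathbf{b}_j,\eta_k^2I_\alpha)$ density when $r$ lies in the $j$-th region; $f^{(m)}_{R_k}$ is the $\mathcal{N}(G_k^{(m)},\sigma_k^2)$ density. Conventions: $Q(-\infty)=1$, $Q(+\infty)=0$, $e^{-(\pm\infty)^2}=0$.
   Formalization: The displayed equation omits the weights 1/σ_k² and fails for unequal σ_k; the formal theorem proves it with these weights restored for arbitrary σ_k, and exactly as displayed when all σ_k are equal. *)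

(* Defs.v *)
(* Library: MathComp and MathComp-Analysis; the reals are any [R : realType]. *)
From mathcomp Require Import all_boot all_order all_algebra.
From mathcomp Require Import all_classical all_reals all_analysis.

Set Implicit Arguments.
Unset Strict Implicit.
Unset Printing Implicit Defensive.

Import Order.TTheory GRing.Theory Num.Theory.
Import numFieldNormedType.Exports.

Local Open Scope classical_set_scope.
Local Open Scope ring_scope.

(* The product rule for every subfamily follows by taking [B i = setT] for the
   indices to be left out. *)
Definition mutually_independent (d : measure_display) (Omega : measurableType d)
    (R : realType) (P : probability Omega R) (I : finType)
    (X : I -> Omega -> R) : Prop :=
  forall B : I -> set R, (forall i, measurable (B i)) ->
    fine (P [set w | forall i, B i (X i w)]) =
    \prod_(i : I) fine (P (X i @^-1` B i)).

Definition has_normal_law (d : measure_display) (Omega : measurableType d)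
    (R : realType) (P : probability Omega R) (X : Omega -> R) (m s : R) : Prop :=
  forall A : set R, measurable A -> P (X @^-1` A) = normal_prob m s A.

(* [cond_mean_near P X Z z e] is E[X | Z in the sup-norm ball of radius e
   around z].  Its limit [cond_exp_at P X Z z] as e tends to 0 is the pointwise
   conditional expectation E[X | Z = z]: by Lebesgue differentiation it agrees,
   for almost every z under the law of Z, with every version of E[X | Z], and it
   is the usual integral against the conditional density when there are
   continuous densities.  It makes sense at each individual z. *)
Definition near_event (Omega : Type) (R : realType) (I : finType)
    (Z : I -> Omega -> R) (z : I -> R) (e : R) : set Omega :=
  [set w | forall i, `|Z i w - z i| < e].

Definition cond_mean_near (d : measure_display) (Omega : measurableType d)
    (R : realType) (P : probability Omega R) (X : Omega -> R)
    (I : finType) (Z : I -> Omega -> R) (z : I -> R) (e : R) : R :=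
  (\int[P]_(w in near_event Z z e) X w) / fine (P (near_event Z z e)).

Definition cond_exp_at (d : measure_display) (Omega : measurableType d)
    (R : realType) (P : probability Omega R) (X : Omega -> R)
    (I : finType) (Z : I -> Omega -> R) (z : I -> R) : R :=
  lim (cond_mean_near P X Z z e @[e --> 0^'+]).

(* [Rintegral] and [lim] are total, so that existence is a separate claim. *)
Definition has_cond_exp_at (d : measure_display) (Omega : measurableType d)
    (R : realType) (P : probability Omega R) (X : Omega -> R)
    (I : finType) (Z : I -> Omega -> R) (z : I -> R) : Prop :=
  P.-integrable setT (EFin \o X) /\
  cvg (cond_mean_near P X Z z e @[e --> 0^'+]).

(* Levels are numbered from 0: the region of level [j < M] lies between [tau j]
   and [tau j.+1], so [tau 0] and [tau M] are the outer boundaries.  Values of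
   [tau] beyond index [M] are irrelevant. *)
Definition quantizer_boundaries (R : realType) (M : nat) (tau : nat -> \bar R)
    : Prop :=
  [/\ tau 0%N = -oo%E, tau M = +oo%E &
      forall i j : nat, (i < j <= M)%N -> (tau i < tau j)%E].

(* [q r] is the level of the region containing [r]; a boundary point may go to
   either of the two adjacent regions. *)
Definition quantizes (R : realType) (M : nat) (tau : nat -> \bar R)
    (q : R -> 'I_M) : Prop :=
  forall r : R, (tau (q r) <= r%:E <= tau (q r).+1)%E.

Definition bitvec (R : realType) (a : nat) (s : a.-tuple bool) : 'cV[R]_a :=
  \col_i (tnth s i)%:R.

Definition sqnorm (R : realType) (a : nat) (v : 'cV[R]_a) : R :=
  (v^T *m v) 0 0.

Definition Qfun (R : realType) (x : \bar R) : R :=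
  (Num.sqrt (2 * pi))^-1 *
  \int[lebesgue_measure]_(t in [set t : R | (x < t%:E)%E]) expR (- t ^+ 2 / 2).

(* exp (- (t - g)^2 / (2 s^2)), equal to 0 at infinite [t]. *)
Definition gauss_exp (R : realType) (t : \bar R) (g s : R) : R :=
  if t is r%:E then expR (- (r - g) ^+ 2 / (2 * s ^+ 2)) else 0.

(* Density at [v] of N(mu, s^2 I) on R^a. *)
Definition gauss_vec_pdf (R : realType) (a : nat) (mu : 'cV[R]_a) (s : R)
    (v : 'cV[R]_a) : R :=
  expR (- sqnorm (v - mu) / (2 * s ^+ 2)) / (2 * pi * s ^+ 2) `^ (a%:R / 2).

(* In the four definitions below [g] is the value G_k^(m), [s] and [h] are the
   standard deviations sigma_k and eta_k, and [z] is the value of Z_k. *)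
Definition DeltaT (R : realType) (tau : nat -> \bar R) (g s : R) (j : nat) : R :=
  Qfun ((tau j - g%:E) * (s^-1)%:E)%E - Qfun ((tau j.+1 - g%:E) * (s^-1)%:E)%E.

Definition fZ (R : realType) (a : nat) (b : 'I_(2 ^ a) -> a.-tuple bool)
    (q : R -> 'I_(2 ^ a)) (g s h : R) (z : 'cV[R]_a) : R :=
  \int[lebesgue_measure]_(r in setT)
    (gauss_vec_pdf (bitvec R (b (q r))) h z * normal_pdf g s r).

Definition Acoef (R : realType) (a : nat) (tau : nat -> \bar R)
    (b : 'I_(2 ^ a) -> a.-tuple bool) (q : R -> 'I_(2 ^ a))
    (s h : R) (z : 'cV[R]_a) (g : R) : R :=
  \sum_(j < 2 ^ a)
    expR (- sqnorm (z - bitvec R (b j)) / (2 * h ^+ 2)) /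
      (fZ b q g s h z * (2 * pi * h ^+ 2) `^ (a%:R / 2)) *
    (Num.sqrt (s ^+ 2 / (2 * pi)) * gauss_exp (tau j) g s
     - Num.sqrt (s ^+ 2 / (2 * pi)) * gauss_exp (tau j.+1) g s
     + g * DeltaT tau g s j).

Definition Bcoef (R : realType) (a : nat) (tau : nat -> \bar R)
    (b : 'I_(2 ^ a) -> a.-tuple bool) (q : R -> 'I_(2 ^ a))
    (s h : R) (z : 'cV[R]_a) (g : R) : R :=
  \sum_(j < 2 ^ a)
    expR (- sqnorm (z - bitvec R (b j)) / (2 * h ^+ 2)) /
      (fZ b q g s h z * (2 * pi * h ^+ 2) `^ (a%:R / 2)) *
    DeltaT tau g s j.

Definition partial (R : realType) (L : nat) (f : 'rV[R]_L -> R) (t : 'I_L)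
    (theta : 'rV[R]_L) : R :=
  'D_(delta_mx 0 t) f theta.

(* Main.v *)
(* Let U_k = R_k ~ N(G_k^(m), sigma_k^2).  Splitting the event
   {|Z_c - z_c| < e for all c} according to the levels of the U_k, independence
   turns E[h(U_l); event] into a product over the sensors, all of whose factors
   except the l-th also occur in P(event).  Hence E[h(U_l) | event] only involves
   sensor l, and, since P(|N - c| < e) / 2e tends to the density of N at c, it
   tends to
     (sum_j E[h(U_l); U_l in region j] f(z_l | b_j)) / f_Z(z_l).
   For h = 1 and h = id the truncated Gaussian moments give B = 1 and A.  So T is
   an explicit quadratic function of the numbers G_k(theta), and differentiating it
   gives sum_k sigma_k^-2 dG_k (A_k - G_k), which is the claim as B_k = 1. *)

Require Import Defs.
From mathcomp Require Import all_boot all_order all_algebra.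
From mathcomp Require Import all_classical all_reals all_analysis.
From mathcomp Require Import measurable_realfun ring lra.

Set Implicit Arguments.
Unset Strict Implicit.
Unset Printing Implicit Defensive.

Import Order.TTheory GRing.Theory Num.Theory.
Import numFieldNormedType.Exports.

Local Open Scope classical_set_scope.
Local Open Scope ring_scope.

(** * Lebesgue and normal integrals *)

(** Conditional means are limits along shrinking balls, so their existence has to be proved at every
    [z], although numerator and denominator both tend to 0. Once the other sensors have cancelled,
    dividing both by [(2 * e) ^+ a], one factor per coordinate of the remaining observation, gives
    finite limits. The limiting denominator is positive since Gaussian noise densities vanish
    nowhere and some level has positive probability. The log-likelihood and the score are both
    quadratic polynomials in the [R_k], so a single limit statement with arbitrary coefficients
    serves both. The conditional second moment stays an unspecified number: in [T] its coefficient
    does not involve theta, and in the score it is 0. The weights [(sigma k ^+ 2)^-1] stand inside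
    the sums over the sensors. A common value factors out, whence the separate conclusion for equal
    deviations. The quantizer [q] is prescribed only up to the boundary points, so level sets are
    handled modulo finite sets. *)

Lemma lebesgue_measure_affine (R : realType) (s m : R) (A : set R) :
  s != 0 -> measurable A ->
  lebesgue_measure A =
  (`|s|%:E * lebesgue_measure ((fun x : R => (s * x + m)%R) @^-1` A))%E.
Proof.
move=> s0 mA.
pose f : R -> R := fun x => s * x + m.
have mf : measurable_fun setT (f : measurableTypeR R -> measurableTypeR R).
  exact: measurable_funD.
pose nu := mscale (NngNum (normr_ge0 s))
  (pushforward lebesgue_measure (f : measurableTypeR R -> measurableTypeR R)).
transitivity (nu mf A); last by [].
(* Half-open intervals determine the measure. For negative [s] the closed end of the preimage moves
   to the other side, which leaves its length unchanged. *)
apply: lebesgue_measure_unique => // _ [[a b]] _ <-.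
transitivity (`|s|%:E * lebesgue_measure (f @^-1` `]a, b]))%E; last by [].
have [sp|sn] := ltP 0 s.
  have -> : f @^-1` `]a, b] = `](a - m) / s, (b - m) / s]%classic.
    apply/seteqP; split => x /=; rewrite !in_itv/= ltr_pdivrMr// ler_pdivlMr//;
    rewrite /f ltrBlDr lerBrDr mulrC //.
  rewrite !lebesgue_measure_itv/= !lte_fin ltr_pM2r ?invr_gt0// ltrD2r gtr0_norm//.
  case: ifPn => _; last by rewrite mule0.
  by rewrite -!EFinB -EFinM; congr EFin; field; rewrite gt_eqF.
have {}sn : s < 0 by rewrite lt_neqAle s0.
have -> : f @^-1` `]a, b] = `[(b - m) / s, (a - m) / s[%classic.
  apply/seteqP; split => x /=; rewrite !in_itv/= ltr_ndivlMr// ler_ndivrMr//;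
  by rewrite /f ltrBlDr lerBrDr mulrC andbC.
rewrite !lebesgue_measure_itv/= !lte_fin ltr_nM2r ?invr_lt0// ltrD2r ltr0_norm//.
case: ifPn => _; last by rewrite mule0.
by rewrite -!EFinB -EFinM; congr EFin; field; rewrite lt_eqF.
Qed.

Lemma ge0_integral_affine (R : realType) (s m : R) (D : set R) (f : R -> \bar R) :
  s != 0 -> measurable D -> measurable_fun D f -> (forall x, 0 <= f x)%E ->
  (\int[lebesgue_measure]_(x in D) f x =
   `|s|%:E * \int[lebesgue_measure]_(x in (fun x : R => (s * x + m)%R) @^-1` D)
     f (s * x + m)%R)%E.
Proof.
move=> s0 mD mf f0.
pose g : R -> R := fun x => s * x + m.
have mg : measurable_fun setT (g : measurableTypeR R -> measurableTypeR R).
  exact: measurable_funD.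
pose nu := mscale (NngNum (normr_ge0 s))
  (pushforward lebesgue_measure (g : measurableTypeR R -> measurableTypeR R)).
transitivity (\int[nu mg]_(x in D) f x)%E.
  apply: eq_measure_integral => A mA _.
  exact: (lebesgue_measure_affine m s0 mA).
rewrite ge0_integral_mscale//; congr (_ * _)%E.
by rewrite ge0_integral_pushforward.
Qed.

(** Change of variables is available for the Radon-Nikodym derivative of [normal_prob]. That
    derivative agrees almost everywhere with [normal_pdf], because both have the same integral over
    every measurable set. *)
Lemma ge0_integral_normal_prob (R : realType) (m s : R) (D : set R)
    (f : R -> \bar R) :
  measurable D -> measurable_fun D f -> (forall x, 0 <= f x)%E ->
  (\int[normal_prob m s]_(x in D) f x =
   \int[lebesgue_measure]_(x in D) (f x * (normal_pdf m s x)%:E))%E.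
Proof.
move=> mD mf f0.
have dom := normal_prob_dominates m s.
rewrite -(Radon_Nikodym_SigmaFinite.change_of_variables dom)//.
have iRN := Radon_Nikodym_SigmaFinite.f_integrable dom.
apply: ae_eq_integral => //.
- by apply: emeasurable_funM => //; apply: measurable_funTS; exact: measurable_int iRN.
- apply: emeasurable_funM => //; apply: measurable_funTS; apply/measurable_EFinP.
  exact: measurable_normal_pdf.
- apply: ae_eqe_mul2l => /=.
  apply: integral_ae_eq => //=.
  + exact: integrableS iRN.
  + by apply: measurable_funTS; apply/measurable_EFinP; exact: measurable_normal_pdf.
  + by move=> E _ mE; rewrite -Radon_Nikodym_SigmaFinite.f_integral.
Qed.

Lemma normal_law_shift (d : measure_display) (Omega : measurableType d)
    (R : realType) (P : probability Omega R) (X : Omega -> R) (g s : R) :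
  s != 0 -> has_normal_law P X 0 s ->
  has_normal_law P (fun w => g + X w) g s.
Proof.
move=> s0 hX A mA.
have mpre : measurable ((fun x : R => 1 * x + g) @^-1` A).
  by rewrite -[X in measurable X]setTI; apply: measurable_funD.
have -> : (fun w => g + X w) @^-1` A = X @^-1` ((fun x : R => 1 * x + g) @^-1` A).
  by apply/seteqP; split => w /=; rewrite mul1r addrC.
rewrite (hX _ mpre) /normal_prob; apply/esym.
rewrite (@ge0_integral_affine R 1 g A (fun x => (normal_pdf g s x)%:E))//.
- rewrite normr1 mul1e; apply: eq_integral => x _.
  by rewrite !normal_pdfE// /normal_fun mul1r addrK subr0.
- by apply: measurable_funTS; apply/measurable_EFinP; exact: measurable_normal_pdf.
- by move=> x; rewrite lee_fin normal_pdf_ge0.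
Qed.

Section normal_law.
Context (d : measure_display) (Omega : measurableType d) (R : realType).
Variables (P : probability Omega R) (X : Omega -> R) (m s : R).
Hypotheses (mX : measurable_fun setT X) (hX : has_normal_law P X m s).

Lemma ge0_integral_normal_law (D : set R) (f : R -> \bar R) :
  measurable D -> measurable_fun D f -> (forall x, 0 <= f x)%E ->
  (\int[P]_(w in X @^-1` D) f (X w) =
   \int[lebesgue_measure]_(x in D) (f x * (normal_pdf m s x)%:E))%E.
Proof.
move=> mD mf f0.
rewrite -ge0_integral_normal_prob//.
have mX' : measurable_fun setT (X : Omega -> measurableTypeR R) by [].
transitivity (\int[pushforward P (X : Omega -> measurableTypeR R)]_(x in D) f x)%E.
  by rewrite ge0_integral_pushforward.
by apply: eq_measure_integral => A mA _; exact: hX.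
Qed.

(** Positive and negative parts are transported separately. The density is nonnegative, so
    multiplying by it commutes with taking the maximum with 0, and [fine] is applied to equal
    extended reals. *)
Lemma Rintegral_normal_law (D : set R) (f : R -> R) :
  measurable D -> measurable_fun setT f ->
  \int[P]_(w in X @^-1` D) f (X w) =
  \int[lebesgue_measure]_(x in D) (f x * normal_pdf m s x).
Proof.
move=> mD mf; congr fine.
have mEf : measurable_fun D (EFin \o f).
  by apply: measurable_funTS; exact/measurable_EFinP.
rewrite integralE [RHS]integralE; congr (_ - _)%E.
- transitivity (\int[P]_(w in X @^-1` D) ((EFin \o f)^\+ (X w)))%E.
    by apply: eq_integral => w _;
      rewrite !unlock.
  rewrite (ge0_integral_normal_law mD (measurable_funepos mEf))//.
  apply: eq_integral => x _; rewrite !unlock /= EFinM.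
  by rewrite maxe_pMl ?mul0e// lee_fin normal_pdf_ge0.
- transitivity (\int[P]_(w in X @^-1` D) ((EFin \o f)^\- (X w)))%E.
    by apply: eq_integral => w _;
      rewrite !unlock.
  rewrite (ge0_integral_normal_law mD (measurable_funeneg mEf))//.
  apply: eq_integral => x _; rewrite !unlock /=.
  by rewrite -mulNr EFinM maxe_pMl ?mul0e// lee_fin normal_pdf_ge0.
Qed.

Lemma integrable_normal_law (f : R -> R) :
  measurable_fun setT f ->
  lebesgue_measure.-integrable setT (EFin \o (fun x => f x * normal_pdf m s x)) ->
  P.-integrable setT (EFin \o (f \o X)).
Proof.
move=> mf /integrableP[_ fi]; apply/integrableP; split.
  by apply/measurable_EFinP; exact: measurableT_comp.
have := @ge0_integral_normal_law setT (fun x => `|(f x)%:E|)%E.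
rewrite preimage_setT => -> //; last first.
  by apply: measurableT_comp => //; exact/measurable_EFinP.
move: fi; congr (_ < _)%E; apply: eq_integral => x _ /=.
by rewrite normrM EFinM (ger0_norm (normal_pdf_ge0 _ _ _)).
Qed.

End normal_law.

(** A quadratic factor is absorbed by passing to the normal density of deviation [2 * s]. Every
    integrability of first and second Gaussian moments below is an instance, up to recentring the
    polynomial. *)
Lemma integrable_normal_pdf_quad (R : realType) (m s a b c : R) : s != 0 ->
  lebesgue_measure.-integrable setT
    (EFin \o (fun x => (a * (x - m) ^+ 2 + b * (x - m) + c) * normal_pdf m s x)).
Proof.
move=> s0.
have s20 : 2 * s != 0 by rewrite mulf_neq0.
(* The exponents for deviations [s] and [2 * s] differ by [3 / (8 s^2)] times the squared distance
   to [m]. The constant is the inverse of this gap times the ratio of the two peaks. *)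
pose k := 8 / 3 * s ^+ 2 * normal_peak s / normal_peak (2 * s).
have k0 : 0 <= k.
  apply: divr_ge0; last exact: normal_peak_ge0.
  by apply: mulr_ge0; last exact: normal_peak_ge0; rewrite mulr_ge0 ?sqr_ge0.
(* [u <= exp u] with [u = 3 (x - m)^2 / (8 s^2)] *)
have sqr_le x : (x - m) ^+ 2 * normal_pdf m s x <= k * normal_pdf m (2 * s) x.
  rewrite !normal_pdfE// /k; set p := normal_peak s; set p2 := normal_peak _.
  have p20 : p2 != 0 by rewrite gt_eqF ?normal_peak_gt0.
  set t := x - m; set F := normal_fun m s x; set F2 := normal_fun _ _ x.
  have -> : 8 / 3 * s ^+ 2 * p / p2 * (p2 * F2) = p * (8 / 3 * s ^+ 2 * F2) by field.
  rewrite mulrCA; apply: ler_wpM2l; first exact: normal_peak_ge0.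
  have -> : F = F2 / expR (3 * t ^+ 2 / (8 * s ^+ 2)).
    by rewrite /F /F2 /normal_fun -expRN -expRD; congr expR; rewrite -/t; field.
  have := expR_ge1Dx (3 * t ^+ 2 / (8 * s ^+ 2)).
  set E := expR _ => hE.
  have E0 : 0 < E by exact: expR_gt0.
  rewrite mulrCA [leRHS]mulrC; apply: ler_wpM2l; first exact: expR_ge0.
  rewrite ler_pdivrMr//.
  have -> : t ^+ 2 = (8 / 3 * s ^+ 2) * (3 * t ^+ 2 / (8 * s ^+ 2)) by field.
  rewrite ler_pM2l; last by rewrite mulr_gt0// exprn_even_gt0.
  by rewrite (le_trans _ hE)// lerDr.
pose h : R -> R := fun x =>
  (`|a| + `|b|) * (k * normal_pdf m (2 * s) x) + (`|b| + `|c|) * normal_pdf m s x.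
apply: (@le_integrable _ _ _ lebesgue_measure _ measurableT _ (EFin \o h)) => //.
- apply/measurable_EFinP; apply: measurable_funM; last exact: measurable_normal_pdf.
  apply: measurable_funD => //; apply: measurable_funD; apply: measurable_funM => //;
    try apply: measurable_funX; exact: measurable_funB.
- move=> x _ /=; rewrite lee_fin [leRHS]ger0_norm; last first.
    by apply: addr_ge0; apply: mulr_ge0; rewrite ?addr_ge0 ?normal_pdf_ge0//;
      apply: mulr_ge0 => //; exact: normal_pdf_ge0.
  rewrite normrM (ger0_norm (normal_pdf_ge0 _ _ _)).
  have p0 := normal_pdf_ge0 m s x.
  rewrite /h; move: (sqr_le x) p0; set p := normal_pdf m s x; set p2 := k * _.
  set t := x - m => hp p0.
  apply: (@le_trans _ _ ((`|a| + `|b|) * (t ^+ 2 * p) + (`|b| + `|c|) * p)).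
    have -> : (`|a| + `|b|) * (t ^+ 2 * p) + (`|b| + `|c|) * p =
      ((`|a| + `|b|) * t ^+ 2 + (`|b| + `|c|)) * p by ring.
    apply: ler_wpM2r => //.
    have ha : `|a * t ^+ 2| = `|a| * t ^+ 2.
      by rewrite normrM [`|t ^+ 2|]ger0_norm// sqr_ge0.
    have hb : `|b * t| <= `|b| * (t ^+ 2 + 1).
      rewrite normrM ler_wpM2l// -(real_normK (num_real t)).
      by have := normr_ge0 t; nra.
    have := ler_normD (a * t ^+ 2) (b * t).
    have := ler_normD (a * t ^+ 2 + b * t) c.
    rewrite ha; lra.
  by rewrite lerD2r ler_wpM2l// addr_ge0.
- rewrite (_ : EFin \o h = (fun x =>
    (((`|a| + `|b|) * k)%:E * (normal_pdf m (2 * s) x)%:E)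
    + (`|b| + `|c|)%:E * (normal_pdf m s x)%:E)%E); last first.
    by apply/funext => x; rewrite /h /= mulrA EFinD !EFinM.
  by apply: integrableD => //; apply: integrableZl => //; exact: integrable_normal_pdf.
Qed.

(** The same set as in [Qfun]. Allowing infinite endpoints treats the two outer levels like the
    others. *)
Definition tail (R : realType) (x : \bar R) : set R := [set t : R | (x < t%:E)%E].

Lemma measurable_tail (R : realType) (x : \bar R) : measurable (tail x).
Proof.
case: x => [r| |].
- rewrite (_ : tail _ = `]r, +oo[%classic)//.
  by apply/seteqP; split => t; rewrite /tail /= in_itv/= lte_fin andbT.
- rewrite (_ : tail _ = set0)//.
  by apply/seteqP; split => t; rewrite /tail/=.
- rewrite (_ : tail _ = setT)//.
  by apply/seteqP; split => t; rewrite /tail/= ?ltNyr.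
Qed.

(** The set [D] is known only up to its endpoints, as a quantizer may send a boundary point to
    either side; the two endpoints form a null set. *)
Lemma Rintegral_between (R : realType) (a b : \bar R) (D : set R) (f : R -> R) :
  (a < b)%E -> measurable D -> lebesgue_measure.-integrable setT (EFin \o f) ->
  (forall r, D r -> (a <= r%:E <= b)%E) ->
  (forall r, (a < r%:E)%E -> (r%:E < b)%E -> D r) ->
  \int[lebesgue_measure]_(x in D) f x =
  \int[lebesgue_measure]_(x in tail a) f x - \int[lebesgue_measure]_(x in tail b) f x.
Proof.
move=> ab mD fi Dsub Dsup.
pose D' := tail a `\` tail b.
have mD' : measurable D' by apply: measurableD; exact: measurable_tail.
have fiS E : measurable E -> lebesgue_measure.-integrable E (EFin \o f).
  by move=> mE; exact: (integrableS _ _ (@subsetT _ _) fi).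
have -> : \int[lebesgue_measure]_(x in D) f x = \int[lebesgue_measure]_(x in D') f x.
  (* An infinite endpoint contributes the point 0, the default value of [fine], and [N] remains
     finite. *)
  pose N := [set fine a; fine b].
  have mN : measurable N by apply: measurableU; exact: measurable_set1.
  have N0 : lebesgue_measure N = 0%E.
    apply: countable_lebesgue_measure0; apply: finite_set_countable.
    exact: finite_set2.
  congr fine.
  rewrite (@negligible_integral _ _ _ lebesgue_measure D N)//; last exact: fiS.
  rewrite (@negligible_integral _ _ _ lebesgue_measure D' N)//; last exact: fiS.
  congr (integral _ _ _); apply/seteqP; split=> r [].
    move=> /Dsub /andP[ar rb] rN; split => //; split; rewrite /tail/=.
      rewrite lt_neqAle ar andbT; apply/eqP => ae; apply: rN; left.
      by rewrite ae.
    by apply/negP; rewrite -leNgt.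
  move=> [ar rb] rN; split => //; apply: Dsup => //.
  move/negP : rb; rewrite -leNgt => rb.
  rewrite lt_neqAle rb andbT; apply/eqP => ae; apply: rN; right.
  by rewrite -ae.
have {1}-> : tail a = D' `|` tail b.
  rewrite /D' setUC setDUK// => r; rewrite /tail/=; exact: lt_trans.
rewrite Rintegral_setU//; first by rewrite addrK.
- exact: measurable_tail.
- by apply: fiS; apply: measurableU => //; exact: measurable_tail.
- by apply/disj_setPS => r [[]].
Qed.

(** Lebesgue differentiation at a point of continuity; [2 * e] is the length of the ball. *)
Lemma cvg_normal_pdf_small_ball (R : realType) (m s c : R) : s != 0 ->
  (fine (normal_prob m s [set y | `|c - y| < e]) / (2 * e)) @[e --> 0^'+] -->
  normal_pdf m s c.
Proof.
move=> s0.
have := @lebesgue_differentiation_continuous R (normal_pdf m s) setT c openT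
  (integrable_normal_pdf m s) (@continuous_normal_pdf R m s s0 c) Logic.I.
apply: cvg_trans; apply: near_eq_cvg; near=> e.
by rewrite mulrC mulr_natl.
Unshelve. all: by end_near. Qed.

(** Reflection about [m] preserves Lebesgue measure and exchanges the positive and negative parts of
    a function that is odd about [m]. *)
Lemma Rintegral_reflect (R : realType) (m : R) (D : set R) (f : R -> R) :
  measurable D -> measurable_fun setT f ->
  (forall x, f (- x + 2 * m) = - f x) ->
  \int[lebesgue_measure]_(x in D) f x =
  - \int[lebesgue_measure]_(x in (fun x : R => - x + 2 * m) @^-1` D) f x.
Proof.
move=> mD mf fodd.
have mEf : measurable_fun setT (EFin \o f) by exact/measurable_EFinP.
have N10 : (-1 : R) != 0 by rewrite oppr_eq0 oner_neq0.
have -> : (fun x : R => - x + 2 * m) @^-1` D = (fun x : R => -1 * x + 2 * m) @^-1` D.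
  by apply/seteqP; split => x/=; rewrite mulN1r.
(* Infinite values cause no exception, since [fine] is then 0 on both sides. *)
have fineB_swap (u v : \bar R) : fine (u - v)%E = - fine (v - u)%E.
  by case: u => [u| |]; case: v => [v| |] //=; rewrite ?oppr0// opprB.
have parts g : (forall x, 0 <= g x)%E -> measurable_fun setT g ->
  (\int[lebesgue_measure]_(x in D) g x =
   \int[lebesgue_measure]_(x in (fun x : R => (-1 * x + 2 * m)%R) @^-1` D)
     g (- x + 2 * m)%R)%E.
  move=> g0 mg; rewrite (ge0_integral_affine (2 * m) N10 mD _ g0); last first.
    exact: measurable_funTS.
  by rewrite normrN1 mul1e; apply: eq_integral => x _; rewrite mulN1r.
rewrite /Rintegral integralE [in RHS]integralE -fineB_swap.
rewrite parts//; last exact: measurable_funepos.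
rewrite [X in (_ - X)%E]parts//; last exact: measurable_funeneg.
congr (fine (_ - _)%E); apply: eq_integral => x _.
  by rewrite funeposE funenegE /= fodd.
by rewrite funeposE funenegE /= fodd opprK.
Qed.

Lemma tail_pinfty (R : realType) : tail (+oo%E : \bar R) = set0.
Proof. by apply/seteqP; split => t; rewrite /tail/=. Qed.

Lemma tail_ninfty (R : realType) : tail (-oo%E : \bar R) = setT.
Proof. by apply/seteqP; split => t; rewrite /tail/= ?ltNyr. Qed.

Lemma tail_fin (R : realType) (a : R) : tail a%:E = `]a, +oo[%classic.
Proof. by apply/seteqP; split => t; rewrite /tail/= in_itv/= lte_fin andbT. Qed.

Lemma normal_peakE (R : realType) (s : R) : 0 < s ->
  normal_peak s = s^-1 * (Num.sqrt (2 * pi))^-1.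
Proof.
move=> s0; rewrite /normal_peak -mulrnAr sqrtrM ?sqr_ge0// sqrtr_sqr gtr0_norm//.
by rewrite invfM -mulr_natl.
Qed.

Lemma Rintegral_normal_pdf_tail (R : realType) (g s : R) (x : \bar R) : 0 < s ->
  \int[lebesgue_measure]_(r in tail x) normal_pdf g s r =
  Qfun ((x - g%:E) * (s^-1)%:E)%E.
Proof.
move=> s0; have sn0 : s != 0 by rewrite gt_eqF.
have c0 : 0 < (Num.sqrt (2 * pi))^-1 :> R.
  by rewrite invr_gt0 sqrtr_gt0 mulr_gt0// pi_gt0.
rewrite /Qfun -/(tail _); set y := (_ * _)%E.
have preE : (fun t : R => s * t + g) @^-1` tail x = tail y.
  rewrite /tail /y; apply/seteqP; split => t /=; case: x {y} => [x| |] //=.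
  - by rewrite -EFinB -EFinM !lte_fin ltr_pdivrMr// ltrBlDr mulrC.
  - by move=> _; rewrite addNye gt0_mulNye ?lte_fin ?invr_gt0// ltNyr.
  - by rewrite -EFinB -EFinM !lte_fin ltr_pdivrMr// ltrBlDr mulrC.
  - by rewrite addye// gt0_mulye ?lte_fin ?invr_gt0.
  - by move=> _; exact: ltNyr.
rewrite /Rintegral (ge0_integral_affine g sn0 (measurable_tail x))//; last 2 first.
- by apply: measurable_funTS; apply/measurable_EFinP; exact: measurable_normal_pdf.
- by move=> t; rewrite lee_fin normal_pdf_ge0.
rewrite preE gtr0_norm//.
transitivity (fine (s%:E * \int[lebesgue_measure]_(t in tail y)
    ((s^-1 * (Num.sqrt (2 * pi))^-1)%:E * (expR (- t ^+ 2 / 2))%:E))%E).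
  congr (fine (_ * _)%E); apply: eq_integral => t _.
  rewrite normal_pdfE// normal_peakE// /normal_fun -EFinM; congr (_ * expR _)%:E.
  by field.
rewrite ge0_integralZl_EFin//.
- rewrite muleA -EFinM mulrA divff// mul1r.
  (* An infinite value of the integral would make both sides 0 through [fine]. *)
  case: (integral _ _ _) => [r| |] //=.
    by rewrite gt0_muley ?lte_fin//= mulr0.
  by rewrite gt0_muleNy ?lte_fin//= mulr0.
- exact: measurable_tail.
- apply/measurable_EFinP; apply: measurable_funTS; apply: measurableT_comp => //.
  by apply: measurable_funM => //; apply: measurableT_comp => //; exact: measurable_funX.
- by rewrite mulr_ge0// ?invr_ge0 ltW.
Qed.

(** This primitive is the source of the boundary terms [gauss_exp] in [Acoef]. *)
Lemma is_derive_normal_pdf (R : realType) (g s r : R) : s != 0 ->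
  is_derive r 1 (fun t => - (s ^+ 2 * normal_pdf g s t)) ((r - g) * normal_pdf g s r).
Proof.
move=> s0; rewrite normal_pdfE// /normal_fun.
pose v : R -> R := (- (s ^+ 2 *+ 2)^-1) \*: (id - cst g : R -> R) ^+ 2.
have dv : is_derive r 1 v (- (r - g) / s ^+ 2).
  have d0 := is_deriveX 2 (is_deriveB (is_derive_id r 1) (is_derive_cst g r 1)).
  have d1 := is_deriveZ (- (s ^+ 2 *+ 2)^-1) d0.
  apply: (is_derive_eq d1).
  rewrite subr0 expr1 /GRing.scale/= mulr1 !fctE. by field.
have vE t : v t = - (t - g) ^+ 2 / (s ^+ 2 *+ 2).
  by change (- (s ^+ 2 *+ 2)^-1 * (t - g) ^+ 2 = - (t - g) ^+ 2 / (s ^+ 2 *+ 2)); field.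
have de := is_derive1_comp (is_derive_expR (v r)) dv.
have df := is_deriveZ (- (s ^+ 2 * normal_peak s)) de.
have -> : (fun t =>
    - (s ^+ 2 * (normal_peak s * expR (- (t - g) ^+ 2 / (s ^+ 2 *+ 2))))) =
  (- (s ^+ 2 * normal_peak s)) \*: (expR \o v).
  apply/funext => t; rewrite -vE.
  change (- (s ^+ 2 * (normal_peak s * expR (v t))) =
    - (s ^+ 2 * normal_peak s) * expR (v t)).
  ring.
apply: (is_derive_eq df); rewrite /GRing.scale/= vE; field.
exact: s0.
Qed.

Lemma cvg_normal_pdf_pinfty (R : realType) (g s : R) : s != 0 ->
  normal_pdf g s x @[x --> +oo%R] --> (0 : R).
Proof.
move=> s0.
have -> : normal_pdf g s = fun x =>
    normal_peak s * expR (- ((x - g) ^+ 2 / (s ^+ 2 *+ 2))).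
  by rewrite normal_pdfE//; apply/funext => x; rewrite /normal_fun mulNr.
rewrite -(mulr0 (normal_peak s)); apply: cvgMr.
apply: (cvg_comp (fun x => (x - g) ^+ 2 / (s ^+ 2 *+ 2)) (fun x => expR (- x)));
  last exact: cvgr_expR.
apply/gt0_cvgMly; first by rewrite invr_gt0 mulrn_wgt0// exprn_even_gt0.
apply: (cvg_comp (fun x => x - g) (fun x => x ^+ 2)); first exact: cvg_addrr.
exact: cvgr_expr2.
Qed.

Lemma continuous_centered_normal_pdf (R : realType) (g s : R) : s != 0 ->
  continuous (fun r => (r - g) * normal_pdf g s r).
Proof.
move=> s0 r; apply: cvgM; last exact: continuous_normal_pdf.
by apply: (@cvgB _ R^o); [exact: cvg_id|exact: cvg_cst].
Qed.

(** With [g <= a] the integrand is nonnegative on the half-line, as the improper fundamental theorem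
    of calculus used here requires. *)
Lemma Rintegral_centered_normal_pdf_right (R : realType) (g s a : R) :
  s != 0 -> g <= a ->
  \int[lebesgue_measure]_(r in `]a, +oo[) ((r - g) * normal_pdf g s r) =
  s ^+ 2 * normal_pdf g s a.
Proof.
move=> s0 ga.
have fi := integrable_normal_pdf_quad g 0 1 0 s0.
rewrite Rintegral_itv_obnd_cbnd; last first.
  apply: (integrableS measurableT) => //.
  apply: eq_integrable fi => // r _ /=; congr EFin; ring.
rewrite (@Rintegral_ge0_continuous_FTC2y _ _ (fun t => - (s ^+ 2 * normal_pdf g s t)) a 0).
- by rewrite sub0r opprK.
- by move=> r ar; rewrite mulr_ge0 ?normal_pdf_ge0// subr_ge0 (le_trans ga).
- by apply: continuous_subspaceT; exact: continuous_centered_normal_pdf.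
- rewrite -oppr0 -(mulr0 (s ^+ 2)); apply: cvgN; apply: cvgMr.
  exact: cvg_normal_pdf_pinfty.
- by move=> r _; have [] := is_derive_normal_pdf g r s0.
- apply: cvg_at_right_filter; apply: cvgN; apply: cvgMr.
  exact: continuous_normal_pdf.
- move=> r _; rewrite derive1E; have := is_derive_normal_pdf g r s0.
  by move=> h; rewrite derive_val.
Qed.

Lemma Rintegral_centered_normal_pdf_tail (R : realType) (g s : R) (x : \bar R) :
  s != 0 ->
  \int[lebesgue_measure]_(r in tail x) ((r - g) * normal_pdf g s r) =
  s ^+ 2 * (normal_peak s * gauss_exp x g s).
Proof.
move=> s0.
have fi : lebesgue_measure.-integrable setT
    (EFin \o (fun r => (r - g) * normal_pdf g s r)).
  apply: eq_integrable (integrable_normal_pdf_quad g 0 1 0 s0) => // r _ /=.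
  by congr EFin; ring.
have mf : measurable_fun setT (fun r : R => (r - g) * normal_pdf g s r).
  apply: measurable_funM; last exact: measurable_normal_pdf.
  exact: measurable_funB.
have fodd t : ((- t + 2 * g) - g) * normal_pdf g s (- t + 2 * g) =
    - ((t - g) * normal_pdf g s t).
  rewrite !normal_pdfE// /normal_fun.
  have -> : (- t + 2 * g - g) ^+ 2 = (t - g) ^+ 2 by ring.
  ring.
(* The whole line is invariant under reflection, so the integral equals its own opposite. *)
have total : \int[lebesgue_measure]_(r in setT) ((r - g) * normal_pdf g s r) = 0.
  have := @Rintegral_reflect R g setT _ measurableT mf fodd.
  by rewrite preimage_setT => h; lra.
case: x => [a| |].
- rewrite tail_fin /= -[X in _ = _ * X](_ : normal_pdf g s a = _); last first.
    by rewrite normal_pdfE// /normal_fun mulr_natl.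
  have [ga|ag] := leP g a; first exact: Rintegral_centered_normal_pdf_right.
  (* For [a < g] the integrand changes sign on the tail. The complementary left half-line is
     reflected to the right of [g], and the zero total converts it back to the tail. *)
  have := @Rintegral_reflect R g `]-oo, a] _ (measurable_itv _) mf fodd.
  have -> : (fun t : R => - t + 2 * g) @^-1` `]-oo, a] = `[2 * g - a, +oo[%classic.
    apply/seteqP; split => t /=; rewrite !in_itv/= andbT; lra.
  rewrite -Rintegral_itv_obnd_cbnd; last exact: (integrableS measurableT).
  rewrite Rintegral_centered_normal_pdf_right//; last by lra.
  have -> : normal_pdf g s (2 * g - a) = normal_pdf g s a.
    rewrite !normal_pdfE// /normal_fun.
    by have -> : (2 * g - a - g) ^+ 2 = (a - g) ^+ 2 by ring.
  move=> h; move: total.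
  rewrite -(setUv `]-oo, a]%classic) setCitvl Rintegral_setU//; last 2 first.
  + by rewrite -setCitvl setUv.
  + by rewrite -setCitvl; apply/disj_setPS; rewrite setICr.
  by rewrite h; lra.
- by rewrite tail_pinfty Rintegral_set0 /= !mulr0.
- by rewrite tail_ninfty total /= !mulr0.
Qed.

(** * Independence *)

Section factorization.
Context (d : measure_display) (Omega : measurableType d) (R : realType).
Variables (P : probability Omega R) (X : Omega -> R) (E : set Omega).
Hypotheses (mX : measurable_fun setT X) (mE : measurable E).
Hypothesis indep : forall A : set R, measurable A ->
  P (X @^-1` A `&` E) = (P E * P (X @^-1` A))%E.

(** The image under [X] of [P] restricted to [E] is [P E] times the law of [X]: this is exactly what
    [indep] says on measurable sets. *)
Lemma ge0_integral_indep (D : set R) (f : R -> \bar R) :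
  measurable D -> measurable_fun setT f -> (forall x, 0 <= f x)%E ->
  (\int[P]_(w in X @^-1` D `&` E) f (X w) =
   P E * \int[P]_(w in X @^-1` D) f (X w))%E.
Proof.
move=> mD mf f0.
have mXD : measurable (X @^-1` D) by rewrite -[X in measurable X]setTI; exact: mX.
have mfX : measurable_fun setT (f \o X) by exact: measurableT_comp.
have fPE : (fine (P E))%:E = P E by rewrite fineK// fin_num_measure.
pose c := NngNum (fine_ge0 (measure_ge0 P E)).
transitivity (\int[mrestr P mE]_(w in X @^-1` D `&` E) f (X w))%E.
  apply: eq_measure_integral => A mA AD; rewrite /mrestr.
  by congr (P _); apply/esym/setIidl => w /AD[].
transitivity (\int[mrestr P mE]_(w in X @^-1` D) f (X w))%E.
  rewrite [RHS](@ge0_negligible_integral _ _ _ _ _ (~` E))//.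
  - by congr integral; rewrite setDE setCK.
  - exact: measurableC.
  - exact: measurable_funTS.
  - by rewrite /= /mrestr setICl measure0.
transitivity (\int[pushforward (mrestr P mE) X]_(x in D) f x)%E.
  by rewrite ge0_integral_pushforward//; exact: measurable_funTS.
pose nu := mscale c (pushforward P X).
transitivity (\int[nu mX]_(x in D) f x)%E.
  apply: eq_measure_integral => A mA AD.
  by apply: (etrans (indep mA)); rewrite -[in LHS]fPE.
rewrite ge0_integral_mscale//; last exact: measurable_funTS.
by rewrite /= fPE ge0_integral_pushforward//; exact: measurable_funTS.
Qed.

Lemma Rintegral_indep (D : set R) (f : R -> R) :
  measurable D -> measurable_fun setT f ->
  P.-integrable setT (EFin \o (f \o X)) ->
  \int[P]_(w in X @^-1` D `&` E) f (X w) =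
  fine (P E) * \int[P]_(w in X @^-1` D) f (X w).
Proof.
move=> mD mf fi.
have mXD : measurable (X @^-1` D) by rewrite -[X in measurable X]setTI; exact: mX.
have mEf : measurable_fun setT (EFin \o f) by exact/measurable_EFinP.
have fiD : P.-integrable (X @^-1` D) (EFin \o (f \o X)).
  exact: integrableS fi.
have fPE : (fine (P E))%:E = P E by rewrite fineK// fin_num_measure.
have pos : (\int[P]_(w in X @^-1` D `&` E) (EFin \o (f \o X))^\+ w =
    P E * \int[P]_(w in X @^-1` D) (EFin \o (f \o X))^\+ w)%E.
  rewrite (_ : EFin \o (f \o X) = (EFin \o f) \o X)// funepos_comp.
  by apply: ge0_integral_indep => //; exact: measurable_funepos.
have neg : (\int[P]_(w in X @^-1` D `&` E) (EFin \o (f \o X))^\- w =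
    P E * \int[P]_(w in X @^-1` D) (EFin \o (f \o X))^\- w)%E.
  rewrite (_ : EFin \o (f \o X) = (EFin \o f) \o X)// funeneg_comp.
  by apply: ge0_integral_indep => //; exact: measurable_funeneg.
rewrite /Rintegral -[in RHS](_ : EFin \o (f \o X) = fun w => (f (X w))%:E)//.
rewrite -[in LHS](_ : EFin \o (f \o X) = fun w => (f (X w))%:E)//.
rewrite integralE [in RHS]integralE pos neg -fPE.
have := integrable_fin_num mXD (integrable_funepos mXD fiD).
have := integrable_fin_num mXD (integrable_funeneg mXD fiD).
case: (integral _ _ _) => [v| |]// _; case: (integral _ _ _) => [u| |]// _.
by rewrite /= mulrBr.
Qed.

End factorization.

Lemma mutually_independent_comp (d : measure_display) (Omega : measurableType d)
    (R : realType) (P : probability Omega R) (I : finType)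
    (X : I -> Omega -> R) (f : I -> R -> R) :
  (forall i, measurable_fun setT (f i)) -> mutually_independent P X ->
  mutually_independent P (fun i w => f i (X i w)).
Proof.
move=> mf hX B mB; apply: (hX (fun i => f i @^-1` B i)) => i.
by rewrite -[X in measurable X]setTI; exact: mf.
Qed.

(** Only one variable is integrated; the constraints on all the others form an event [E] independent
    of it, which factors out. *)
Lemma mutually_independent_Rintegral (d : measure_display)
    (Omega : measurableType d) (R : realType) (P : probability Omega R)
    (I : finType) (X : I -> Omega -> R) (B : I -> set R) (i0 : I) (h : R -> R) :
  (forall i, measurable_fun setT (X i)) -> mutually_independent P X ->
  (forall i, measurable (B i)) -> measurable_fun setT h ->
  P.-integrable setT (EFin \o (h \o X i0)) ->
  \int[P]_(w in [set w | forall i, B i (X i w)]) h (X i0 w) =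
  (\prod_(i | i != i0) fine (P (X i @^-1` B i))) *
  \int[P]_(w in X i0 @^-1` B i0) h (X i0 w).
Proof.
move=> mX hX mB mh hi.
pose E := [set w | forall i, i != i0 -> B i (X i w)].
have mpre i A : measurable A -> measurable (X i @^-1` A).
  by move=> mA; rewrite -[X in measurable X]setTI; exact: mX.
(* Putting an arbitrary [A] in place of [B i0] turns the product rule into independence of [X i0]
   from [E]; the case [A = setT] then gives [P E]. *)
have inter A : X i0 @^-1` A `&` E =
    [set w | forall i, (if i == i0 then A else B i) (X i w)].
  apply/seteqP; split => w /=.
    by move=> [Aw Ew] i; case: eqVneq => [->//|/Ew].
  move=> H; split; first by have := H i0; rewrite eqxx.
  by move=> i i0i; have := H i; rewrite (negbTE i0i).
have mE : measurable E.
  rewrite (_ : E = \bigcap_(i in [set` [pred i | i != i0]]) (X i @^-1` B i)).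
    by apply: fin_bigcap_measurable => // i _; exact: mpre.
  by apply/seteqP; split => w H i /H.
have PE A : measurable A -> P (X i0 @^-1` A `&` E) =
    ((\prod_(i | i != i0) fine (P (X i @^-1` B i))) * fine (P (X i0 @^-1` A)))%:E.
  move=> mA; rewrite -[LHS]fineK; last first.
    by apply: fin_num_measure; apply: measurableI => //; exact: mpre.
  congr EFin; rewrite inter (hX (fun i => if i == i0 then A else B i)).
    rewrite (bigD1 i0)//= eqxx mulrC; congr (_ * _).
    by apply: eq_bigr => i /negbTE ->.
  by move=> i; case: ifP.
have PE1 : P E = (\prod_(i | i != i0) fine (P (X i @^-1` B i)))%:E.
  by have := PE setT measurableT; rewrite preimage_setT setTI probability_setT /= mulr1.
have -> : [set w | forall i, B i (X i w)] = X i0 @^-1` B i0 `&` E.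
  rewrite inter; apply/seteqP; split => w H i; have := H i; by case: eqVneq => [->|].
rewrite (Rintegral_indep (mX i0) mE)//; first by rewrite PE1.
move=> A mA; rewrite PE1 PE// EFinM; congr (_ * _)%E.
by rewrite fineK// fin_num_measure//; exact: mpre.
Qed.

Lemma Rintegral_partition (d : measure_display) (T : measurableType d)
    (R : realType) (mu : {measure set T -> \bar R}) (J : finType) (c : T -> J)
    (D : set T) (f : T -> R) :
  (forall j, measurable (D `&` c @^-1` [set j])) ->
  mu.-integrable D (EFin \o f) ->
  \int[mu]_(x in D) f x = \sum_j \int[mu]_(x in D `&` c @^-1` [set j]) f x.
Proof.
move=> mD fi.
have DE : D = \big[setU/set0]_(j <- index_enum J) (D `&` c @^-1` [set j]).
  rewrite -bigcup_seq; apply/seteqP; split => x; last by case=> j _ [].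
  by move=> Dx; exists (c x) => //=; rewrite mem_index_enum.
have measD : measurable D by rewrite DE; exact: bigsetU_measurable.
rewrite {1}DE /Rintegral integral_bigsetU_EFin//.
- rewrite (eq_bigr (fun j => (\int[mu]_(x in D `&` c @^-1` [set j]) f x)%:E)).
    by rewrite sumEFin.
  move=> j _; rewrite fineK//; apply: integrable_fin_num => //.
  by apply: integrableS fi => //; exact: subIsetl.
- exact: index_enum_uniq.
- apply/trivIsetP => i j _ _ /eqP ij; apply/seteqP; split => // x [[_ ci] [_ cj]].
  by apply: ij; rewrite -ci -cj.
- by rewrite -DE; exact: measurable_int fi.
Qed.

(** * Conditioning quantized noisy sensors on a small ball *)

Section quantized_sensors.
Context (d : measure_display) (Omega : measurableType d) (R : realType).
Variables (P : probability Omega R) (K a : nat) (J : finType).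
Variables (U : 'I_K -> Omega -> R) (N : 'I_K -> 'I_a -> Omega -> R).
Variables (q : R -> J) (lab : J -> 'I_a -> R) (z : 'I_K -> 'I_a -> R).
Variable eta : 'I_K -> R.
Let V (c : 'I_K + 'I_K * 'I_a) : Omega -> R :=
  match c with inl k => U k | inr ki => N ki.1 ki.2 end.
Hypothesis mq : forall j, measurable (q @^-1` [set j]).
Hypothesis eta0 : forall k, eta k != 0.
Hypothesis mU : forall k, measurable_fun setT (U k).
Hypothesis mN : forall k i, measurable_fun setT (N k i).
Hypothesis hN : forall k i, has_normal_law P (N k i) 0 (eta k).
Hypothesis hV : mutually_independent P V.

Let Z (c : 'I_K * 'I_a) (w : Omega) : R := lab (q (U c.1 w)) c.2 + N c.1 c.2 w.
Let zobs (c : 'I_K * 'I_a) : R := z c.1 c.2.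

Let lev j : set R := q @^-1` [set j].
(** For sensor [k] at level [j], [nu] is the probability that the noise carries the label to within
    [e] of the observation. Below, [mom] is the moment of [h] over the level, and [gam] is the limit
    of [nu e k j / (2 * e) ^+ a]. *)
Let nu (e : R) k j : R :=
  \prod_(i < a) fine (P (N k i @^-1` [set y | `|z k i - lab j i - y| < e])).
Let mom (h : R -> R) k j : R := \int[P]_(w in U k @^-1` lev j) h (U k w).
Let gam k j : R := \prod_(i < a) normal_pdf 0 (eta k) (z k i - lab j i).

Let mV c : measurable_fun setT (V c).
Proof. by case: c => [k|ki]; [exact: mU|exact: mN]. Qed.

Let measurable_near (c e : R) : measurable [set y : R | `|c - y| < e].
Proof. exact: (measurable_ball c e). Qed.

Let mUlev k j : measurable (U k @^-1` lev j).
Proof. by rewrite -[X in measurable X]setTI; apply: mU => //; exact: mq. Qed.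

Let event e (phi : {ffun 'I_K -> J}) (c : 'I_K + 'I_K * 'I_a) : set R :=
  match c with
  | inl k => lev (phi k)
  | inr (k, i) => [set y | `|z k i - lab (phi k) i - y| < e]
  end.

Let mevent e phi c : measurable (event e phi c).
Proof. by case: c => [k|[k i]]; [exact: mq|exact: measurable_near]. Qed.

Let cell w := [ffun k => q (U k w)].

(** Once all levels are fixed by [phi], the labels are constants and nearness constrains the noises
    alone, so the event is a rectangle in the independent variables [V]. *)
Let near_event_cell e phi : near_event Z zobs e `&` cell @^-1` [set phi] =
  [set w | forall c, event e phi c (V c w)].
Proof.
apply/seteqP; split => w.
  move=> [nw /= <-] [k|[k i]] /=; rewrite /lev/= ffunE//.
  rewrite distrC; have := nw (k, i).
  by rewrite /Z /zobs /= opprB addrA [N k i w + _]addrC.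
move=> Ew; have Uw k : q (U k w) = phi k by exact: (Ew (inl k)).
split; last by apply/ffunP => k; rewrite ffunE Uw.
move=> [k i]; have := Ew (inr (k, i)); have := Uw k.
by rewrite /Z /zobs /= distrC => ->; rewrite opprB addrA [N k i w + _]addrC.
Qed.

Let measurable_near_cell e phi :
  measurable (near_event Z zobs e `&` cell @^-1` [set phi]).
Proof.
rewrite near_event_cell.
rewrite (_ : [set w | _] = \bigcap_(c in [set: _]) (V c @^-1` event e phi c)).
  apply: fin_bigcap_measurable => // c _.
  by rewrite -[X in measurable X]setTI; apply: mV => //; exact: mevent.
by apply/seteqP; split => w H c; [move=> _; exact: H|exact: (H c)].
Qed.

Lemma measurable_near_event e : measurable (near_event Z zobs e).
Proof.
rewrite (_ : near_event Z zobs e = \bigcup_(phi in [set: {ffun 'I_K -> J}])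
    (near_event Z zobs e `&` cell @^-1` [set phi])).
  exact: fin_bigcup_measurable.
by apply/seteqP; split => w; [move=> nw; exists (cell w)|case=> phi _ []].
Qed.

Let mnear e : measurable (near_event Z zobs e) := measurable_near_event e.

Lemma near_event_Rintegral (h : R -> R) (l : 'I_K) (e : R) :
  measurable_fun setT h -> P.-integrable setT (EFin \o (h \o U l)) ->
  \int[P]_(w in near_event Z zobs e) h (U l w) =
  (\sum_j mom h l j * nu e l j) *
  \prod_(k | k != l) \sum_j mom (cst 1) k j * nu e k j.
Proof.
move=> mh hi.
rewrite (Rintegral_partition (measurable_near_cell e)); last first.
  exact: (integrableS measurableT).
pose t k j := (if k == l then mom h k j else mom (cst 1) k j) * nu e k j.
transitivity (\prod_k \sum_j t k j); last first.
  rewrite (bigD1 l)//=; congr (_ * _).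
    by apply: eq_bigr => j _; rewrite /t eqxx.
  by apply: eq_bigr => k /negbTE kl; apply: eq_bigr => j _; rewrite /t kl.
(* Expanding the product over sensors of sums over levels gives one term per assignment [phi]. *)
rewrite bigA_distr_bigA/=; apply: eq_bigr => phi _.
rewrite near_event_cell.
rewrite (mutually_independent_Rintegral (i0 := inl l) mV hV (mevent e phi) mh hi)/=.
(* The [inl] indices supply the level probabilities, the [inr] indices the noise probabilities,
   regrouped by sensor into [nu]. *)
rewrite big_sumType/= mulrC mulrA /t big_split/=; congr (_ * _); last first.
  rewrite (eq_bigr (fun ki => fine (P (N ki.1 ki.2 @^-1`
      [set y | `|z ki.1 ki.2 - lab (phi ki.1) ki.2 - y| < e])))); last by case.
  by rewrite pair_bigA.
rewrite [RHS](bigD1 l)//= eqxx; congr (_ * _); apply: eq_big => // k kl.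
by rewrite (negbTE (kl : k != l)) /mom Rintegral_cst ?mul1r//; exact: mUlev.
Qed.


Let cvg_nu k j : nu e k j / (2 * e) ^+ a @[e --> 0^'+] --> gam k j.
Proof.
rewrite [X in X @ _](_ : _ = (fun e => \prod_(i < a)
   (fine (P (N k i @^-1` [set y | `|z k i - lab j i - y| < e])) / (2 * e)))).
  apply: cvg_big => [|i _]; first exact: mul_continuous.
  under eq_fun do rewrite (hN _ _ (measurable_near _ _)).
  exact: cvg_normal_pdf_small_ball.
apply/funext => e; rewrite /nu big_split/=; congr (_ * _).
by rewrite prodr_const card_ord exprVn.
Qed.

Let cvg_sum_nu (h : R -> R) k :
  (\sum_j mom h k j * nu e k j) / (2 * e) ^+ a @[e --> 0^'+] -->
  \sum_j mom h k j * gam k j.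
Proof.
rewrite [X in X @ _](_ : _ =
    (fun e => \sum_j mom h k j * (nu e k j / (2 * e) ^+ a))).
  apply: cvg_big => [|j _]; first exact: add_continuous.
  by apply: cvgMr; exact: cvg_nu.
by apply/funext => e; rewrite mulr_suml; apply: eq_bigr => j _; rewrite mulrA.
Qed.

Let gam_gt0 k j : 0 < gam k j.
Proof.
apply: prodr_gt0 => i _; rewrite normal_pdfE//.
by rewrite mulr_gt0 ?normal_peak_gt0// expR_gt0.
Qed.

Let mom1E k j : mom (cst 1) k j = fine (P (U k @^-1` lev j)).
Proof.
by rewrite /mom Rintegral_cst ?mul1r//; exact: mUlev.
Qed.

(** The level probabilities sum to 1, so one of them is nonzero, and it is multiplied by a positive
    density. This is the denominator of the limit. *)
Lemma sum_mom1_gam_gt0 k : 0 < \sum_j mom (cst 1) k j * gam k j.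
Proof.
have m0 j : 0 <= mom (cst 1) k j by rewrite mom1E fine_ge0.
have [j mj] : exists j, mom (cst 1) k j != 0.
  apply: contrapT => /forallNP no.
  have : \sum_j mom (cst 1) k j = 1.
    transitivity (\int[P]_(w in setT) cst 1 (U k w)); last first.
      rewrite Rintegral_cst// mul1r.
      by rewrite -[RHS]/(fine 1%E); congr fine; exact: probability_setT.
    apply/esym.
    rewrite (Rintegral_partition (c := q \o U k)).
    - by apply: eq_bigr => j _; rewrite setTI.
    - by move=> j; rewrite setTI; exact: mUlev.
    - exact: finite_measure_integrable_cst.
  rewrite big1 => [/eqP|j _]; first by rewrite eq_sym oner_eq0.
  by apply/eqP/negP => /negP /no.
rewrite (bigD1 j)//=; apply: ltr_pwDl.
  by rewrite mulr_gt0// lt_neqAle eq_sym mj m0.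
by apply: sumr_ge0 => i _; rewrite mulr_ge0// ltW.
Qed.

Lemma cvg_cond_mean_near (h : R -> R) (l : 'I_K) :
  measurable_fun setT h -> P.-integrable setT (EFin \o (h \o U l)) ->
  cond_mean_near P (h \o U l) Z zobs e @[e --> 0^'+] -->
  (\sum_j mom h l j * gam l j) / (\sum_j mom (cst 1) l j * gam l j).
Proof.
move=> mh hi.
have lim := cvgM (@cvg_sum_nu h l)
  (cvgV (lt0r_neq0 (sum_mom1_gam_gt0 l)) (@cvg_sum_nu (cst 1) l)).
apply: (cvg_trans _ (lim _ _)); apply: near_eq_cvg.
(* Cancelling the factors of the other sensors needs them nonzero for small [e]; this follows from
   the positive limits of the rescaled sums, simultaneously for finitely many [k]. *)
have F0 : \forall e \near 0^'+, forall k, \sum_j mom (cst 1) k j * nu e k j != 0.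
  apply: filter_forall => k.
  have F1 : \forall e \near 0^'+,
      (\sum_j mom (cst 1) k j * nu e k j) / (2 * e) ^+ a != 0.
    by apply: cvgr_neq0 (@cvg_sum_nu (cst 1) k) (lt0r_neq0 (sum_mom1_gam_gt0 k)).
  apply: filterS F1 => e; apply: contraNneq => ->.
  by rewrite mul0r.
near=> e.
have e0 : 0 < e by [].
have Fk : forall k, \sum_j mom (cst 1) k j * nu e k j != 0 by near: e.
rewrite /cond_mean_near.
(* The denominator is the same integral for the constant function 1, so one factorization covers
   both. *)
have -> : fine (P (near_event Z zobs e)) =
    \int[P]_(w in near_event Z zobs e) cst 1 (U l w).
  by rewrite Rintegral_cst ?mul1r.
rewrite !near_event_Rintegral//; last exact: finite_measure_integrable_cst.
set c := (2 * e) ^+ a.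
have c0 : c != 0 by rewrite expf_neq0// mulf_neq0// gt_eqF.
set p := \prod_(k | _) _; have p0 : p != 0 by apply/prodf_neq0 => k _.
set S := \sum_j mom h l j * nu e l j; have := Fk l; set S1 := \sum_j _ => S10.
change (S / c * (S1 / c)^-1 = S * p / (S1 * p)).
by field; rewrite c0 p0 S10.
Unshelve. all: by end_near. Qed.

End quantized_sensors.

(** * Quantizers and their Gaussian moments *)

Lemma sqnormE (R : realType) (a : nat) (v : 'cV[R]_a) :
  sqnorm v = \sum_i v i 0 ^+ 2.
Proof. by rewrite /sqnorm mxE; apply: eq_bigr => i _; rewrite mxE expr2. Qed.

(** Links the vector density in [fZ] with the product of scalar noise densities produced by
    independence; the real power [a / 2] becomes the [a]-th power of a square root. *)
Lemma gauss_vec_pdfE (R : realType) (a : nat) (mu z : 'cV[R]_a) (s : R) : 0 < s ->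
  gauss_vec_pdf mu s z = \prod_(i < a) normal_pdf 0 s (z i 0 - mu i 0).
Proof.
move=> s0; have pi2 : 0 < 2 * pi * s ^+ 2 :> R by rewrite !mulr_gt0 ?pi_gt0 ?exprn_gt0.
under eq_bigr do rewrite normal_pdfE ?gt_eqF// /normal_fun subr0.
rewrite big_split/= prodr_const card_ord -expR_sum mulrC /gauss_vec_pdf.
congr (expR _ * _).
  rewrite sqnormE -sumrN mulr_suml; apply: eq_bigr => i _.
  by rewrite !mxE mulr_natl.
rewrite /normal_peak exprVn; congr (_^-1).
rewrite [a%:R / 2]mulrC powRrM powR12_sqrt ?ltW// powR_mulrn ?sqrtr_ge0//.
by congr (Num.sqrt _ ^+ _); rewrite -mulr_natl; ring.
Qed.

Section quantizer.
Context (R : realType) (M : nat) (tau : nat -> \bar R) (q : R -> 'I_M).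
Hypotheses (htau : quantizer_boundaries M tau) (hq : quantizes tau q).

Let tau_le i j : (i <= j <= M)%N -> (tau i <= tau j)%E.
Proof.
case/andP; rewrite leq_eqVlt => /predU1P[->//|ij] jM.
by have [_ _ tauS] := htau; rewrite ltW// tauS// ij.
Qed.

(** Any other level would, by monotonicity of [tau], put [r] on the wrong side of one of the two
    strict inequalities. *)
Lemma quantizer_level_sup (j : 'I_M) (r : R) :
  (tau j < r%:E)%E -> (r%:E < tau j.+1)%E -> q r = j.
Proof.
move=> jr rj; have /andP[qr rq] := hq r; apply/val_inj/eqP; rewrite /= eqn_leq.
apply/andP; split; rewrite leqNgt; apply/negP => lt.
  have := tau_le (i := j.+1) (j := q r).
  by rewrite lt ltnW//= => /(_ isT) /le_trans/(_ qr); rewrite leNgt rj.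
have := tau_le (i := (q r).+1) (j := j).
by rewrite lt ltnW//= => /(_ isT) /(le_trans rq); rewrite leNgt jr.
Qed.

(** Outside the finite set [N] the level coincides with an interval; inside [N] any subset is
    finite, hence measurable, however [q] treats the boundary. *)
Lemma measurable_quantizer_level (j : 'I_M) : measurable (q @^-1` [set j]).
Proof.
pose N := [set fine (tau j); fine (tau j.+1)].
rewrite (_ : q @^-1` _ = (tail (tau j) `\` tail (tau j.+1) `\` N) `|`
    (q @^-1` [set j] `&` N)).
  apply: measurableU.
    apply: measurableD; first by apply: measurableD; exact: measurable_tail.
    by apply: measurableU; exact: measurable_set1.
  apply: countable_measurable => [r|]; first exact: measurable_set1.
  apply: finite_set_countable.
  by apply: finite_setIr; exact: finite_set2.
apply/seteqP; split => r.
  move=> /= qr; have [Nr|Nr] := pselect (N r); [by right|left; split => //].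
  have := hq r; rewrite qr => /andP[jr rj]; split; rewrite /tail/=.
    by rewrite lt_neqAle jr andbT; apply/eqP => E; apply: Nr; left; rewrite E.
  by apply/negP; rewrite -leNgt.
case=> [[[/= jr /negP]]|[]//]; rewrite -leNgt => rj Nr.
apply: quantizer_level_sup => //.
by rewrite lt_neqAle rj andbT; apply/eqP => E; apply: Nr; right; rewrite -E.
Qed.

Lemma measurable_fun_quantizer (F : 'I_M -> R) :
  measurable_fun setT (fun r => F (q r)).
Proof.
move=> _ A mA; rewrite setTI.
rewrite (_ : _ @^-1` A = \bigcup_(j in F @^-1` A) (q @^-1` [set j])).
  by apply: fin_bigcup_measurable => // j _; exact: measurable_quantizer_level.
by apply/seteqP; split => [r Ar|r [j Aj /= qr]]; [exists (q r)|rewrite /= qr].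
Qed.

Lemma Rintegral_level (j : 'I_M) (f : R -> R) :
  lebesgue_measure.-integrable setT (EFin \o f) ->
  \int[lebesgue_measure]_(r in q @^-1` [set j]) f r =
  \int[lebesgue_measure]_(r in tail (tau j)) f r
  - \int[lebesgue_measure]_(r in tail (tau j.+1)) f r.
Proof.
move=> fi; have [_ _ tauS] := htau.
apply: Rintegral_between => //.
- by apply: tauS; rewrite leqnn ltn_ord.
- exact: measurable_quantizer_level.
- by move=> r /= <-; exact: hq.
- exact: quantizer_level_sup.
Qed.

End quantizer.

Lemma Rintegral_level_normal_pdf (R : realType) (M : nat) (tau : nat -> \bar R)
    (q : R -> 'I_M) (g s : R) (j : 'I_M) :
  quantizer_boundaries M tau -> quantizes tau q -> 0 < s ->
  \int[lebesgue_measure]_(r in q @^-1` [set j]) normal_pdf g s r = DeltaT tau g s j.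
Proof.
move=> htau hq s0; rewrite (Rintegral_level htau hq)//; last exact: integrable_normal_pdf.
by rewrite !Rintegral_normal_pdf_tail.
Qed.

(** Writing [r] as [(r - g) + g], the centred part integrates to the two boundary terms and the
    constant part to [g] times the probability of the level. *)
Lemma Rintegral_level_id_normal_pdf (R : realType) (M : nat) (tau : nat -> \bar R)
    (q : R -> 'I_M) (g s : R) (j : 'I_M) :
  quantizer_boundaries M tau -> quantizes tau q -> 0 < s ->
  \int[lebesgue_measure]_(r in q @^-1` [set j]) (r * normal_pdf g s r) =
  Num.sqrt (s ^+ 2 / (2 * pi)) * gauss_exp (tau j) g s
  - Num.sqrt (s ^+ 2 / (2 * pi)) * gauss_exp (tau j.+1) g s + g * DeltaT tau g s j.
Proof.
move=> htau hq s0; have sn0 : s != 0 by rewrite gt_eqF.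
have mlev := measurable_quantizer_level htau hq j.
have fi1 : lebesgue_measure.-integrable setT
    (EFin \o (fun r => (r - g) * normal_pdf g s r)).
  apply: eq_integrable (integrable_normal_pdf_quad g 0 1 0 sn0) => // r _ /=.
  by congr EFin; ring.
rewrite -(Rintegral_level_normal_pdf g j htau hq s0).
transitivity (\int[lebesgue_measure]_(r in q @^-1` [set j])
    ((r - g) * normal_pdf g s r + g * normal_pdf g s r)).
  by apply: eq_Rintegral => r _; ring.
rewrite RintegralD//; last 2 first.
- exact: (integrableS measurableT).
- apply: (integrableS measurableT) => //.
  apply: eq_integrable (integrable_normal_pdf_quad g 0 0 g sn0) => // r _ /=.
  by congr EFin; ring.
rewrite RintegralZl//; last first.
  by apply: (integrableS measurableT) => //; exact: integrable_normal_pdf.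
congr (_ + _); rewrite (Rintegral_level htau hq)//.
rewrite !Rintegral_centered_normal_pdf_tail// normal_peakE//.
have -> : Num.sqrt (s ^+ 2 / (2 * pi)) = s ^+ 2 * (s^-1 * (Num.sqrt (2 * pi))^-1).
  rewrite sqrtrM ?sqr_ge0// sqrtr_sqr gtr0_norm// sqrtrV ?mulr_ge0 ?pi_ge0//.
  by set c := (Num.sqrt (2 * pi))^-1; field.
by rewrite !mulrA.
Qed.

(** * Conditional means given the observations *)

Section cond_exp_sums.
Context (d : measure_display) (Omega : measurableType d) (R : realType).
Variables (P : probability Omega R) (I : finType) (Z : I -> Omega -> R) (z : I -> R).

Lemma cvg_cond_mean_near_sum (J : finType) (X : J -> Omega -> R) (c : J -> R) :
  (forall e, measurable (near_event Z z e)) ->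
  (forall j, P.-integrable setT (EFin \o X j)) ->
  (forall j, cond_mean_near P (X j) Z z e @[e --> 0^'+] --> c j) ->
  P.-integrable setT (EFin \o (fun w => \sum_j X j w)) /\
  cond_mean_near P (fun w => \sum_j X j w) Z z e @[e --> 0^'+] --> \sum_j c j.
Proof.
move=> mnear Xi Xc.
have sumi (s : seq J) : P.-integrable setT (EFin \o (fun w => \sum_(j <- s) X j w)).
  elim: s => [|j s ih].
    rewrite (_ : EFin \o _ = cst 0%E); first exact: integrable0.
    by apply/funext => w /=; rewrite big_nil.
  rewrite (_ : EFin \o _ =
    ((EFin \o X j) \+ (EFin \o (fun w => (\sum_(j <- s) X j w)%R)))%E).
    exact: integrableD.
  by apply/funext => w /=; rewrite big_cons.
split; first exact: sumi.
rewrite (_ : cond_mean_near P _ Z z = fun e => \sum_j cond_mean_near P (X j) Z z e).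
  by apply: cvg_big => [|j _]; [exact: add_continuous|exact: Xc].
apply/funext => e; rewrite /cond_mean_near -mulr_suml; congr (_ / _).
elim: (index_enum J) => [|j s ih].
  rewrite big_nil; under eq_Rintegral do rewrite big_nil.
  by rewrite Rintegral_cst// mul0r.
rewrite big_cons -ih -RintegralD//; last 2 first.
- exact: integrableS (Xi j).
- exact: integrableS (sumi s).
by apply: eq_Rintegral => w _; rewrite big_cons.
Qed.

End cond_exp_sums.

Section em_moments.
Context (d : measure_display) (Omega : measurableType d) (R : realType).
Variables (P : probability Omega R) (K a : nat).
Variables (U : 'I_K -> Omega -> R) (N : 'I_K -> 'I_a -> Omega -> R).
Variables (g sigma eta : 'I_K -> R) (tau : nat -> \bar R).
Variables (q : R -> 'I_(2 ^ a)) (b : 'I_(2 ^ a) -> a.-tuple bool).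
Variable z : 'I_K -> 'cV[R]_a.
Hypotheses (sigma0 : forall k, 0 < sigma k) (eta0 : forall k, 0 < eta k).
Hypotheses (htau : quantizer_boundaries (2 ^ a) tau) (hq : quantizes tau q).
Hypothesis mU : forall k, measurable_fun setT (U k).
Hypothesis mN : forall k i, measurable_fun setT (N k i).
Hypothesis hU : forall k, has_normal_law P (U k) (g k) (sigma k).
Hypothesis hN : forall k i, has_normal_law P (N k i) 0 (eta k).
Hypothesis hV : mutually_independent P (fun c : 'I_K + 'I_K * 'I_a =>
  match c with inl k => U k | inr ki => N ki.1 ki.2 end).

Let Z (c : 'I_K * 'I_a) (w : Omega) : R :=
  bitvec R (b (q (U c.1 w))) c.2 0 + N c.1 c.2 w.
Let zobs (c : 'I_K * 'I_a) : R := z c.1 c.2 0.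
Let lev j : set R := q @^-1` [set j].
Let mlev j : measurable (lev j) := measurable_quantizer_level htau hq j.
Let mom (h : R -> R) k j : R := \int[P]_(w in U k @^-1` lev j) h (U k w).
Let gam k j : R := gauss_vec_pdf (bitvec R (b j)) (eta k) (z k).
(** The triple lists the coefficients of degrees 2, 1 and 0. Quadratics are closed under linear
    combinations, so one integrability fact covers all that follow. *)
Let quad (p : R * R * R) (r : R) : R := p.1.1 * r ^+ 2 + p.1.2 * r + p.2.

Let measurable_quad p : measurable_fun setT (quad p).
Proof.
apply: measurable_funD => //; apply: measurable_funD; apply: measurable_funM => //.
Qed.

Let integrable_quad p k : P.-integrable setT (EFin \o (quad p \o U k)).
Proof.
have s0 : sigma k != 0 by rewrite gt_eqF.
apply: (integrable_normal_law (mU k) (@hU k) (measurable_quad p)).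
(* The coefficients are those of the same polynomial expanded around [g k]. *)
apply: eq_integrable (integrable_normal_pdf_quad (g k) p.1.1
  (2 * p.1.1 * g k + p.1.2) (p.1.1 * g k ^+ 2 + p.1.2 * g k + p.2) s0) => // r _ /=.
by congr (_ * _)%:E; rewrite /quad; ring.
Qed.

Let mom1E k j : mom (cst 1) k j = DeltaT tau (g k) (sigma k) j.
Proof.
rewrite /mom (Rintegral_normal_law (mU k) (@hU k))//.
rewrite -(Rintegral_level_normal_pdf (g k) j htau hq (sigma0 k)).
by apply: eq_Rintegral => r _; rewrite mul1r.
Qed.

(** The label density is constant on each level, so the integral defining [fZ] splits into level
    probabilities weighted by [gam]. *)
Let fZE k : fZ b q (g k) (sigma k) (eta k) (z k) = \sum_j mom (cst 1) k j * gam k j.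
Proof.
apply: (etrans (@Rintegral_partition _ _ R lebesgue_measure _ q setT
  (fun r => gam k (q r) * normal_pdf (g k) (sigma k) r) _ _)).
- by move=> j; rewrite setTI; exact: mlev.
(* A bound for every label density at once, used to dominate the integrand. *)
- pose c := \sum_j gam k j.
  have gam0 j : 0 <= gam k j.
    by rewrite /gam gauss_vec_pdfE//; apply: prodr_ge0 => i _; exact: normal_pdf_ge0.
  have c0 : 0 <= c by exact: sumr_ge0.
  apply: (@le_integrable _ _ _ lebesgue_measure _ measurableT _
    (fun r => c%:E * (normal_pdf (g k) (sigma k) r)%:E)%E) => //.
  + apply/measurable_EFinP; apply: measurable_funM; last exact: measurable_normal_pdf.
    exact: (measurable_fun_quantizer htau hq (gam k)).
  + move=> r _ /=; rewrite lee_fin [leLHS]normrM [leRHS]normrM.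
    apply: ler_wpM2r => //; rewrite (ger0_norm (gam0 _)) (ger0_norm c0).
    by rewrite /c (bigD1 (q r))//= lerDl sumr_ge0.
  + by apply: integrableZl => //; exact: integrable_normal_pdf.
- apply: eq_bigr => j _; rewrite setTI mom1E mulrC.
  rewrite -(Rintegral_level_normal_pdf (g k) j htau hq (sigma0 k)).
  transitivity (\int[lebesgue_measure]_(r in lev j)
      (gam k j * normal_pdf (g k) (sigma k) r)).
    by apply: eq_Rintegral => r; rewrite inE => /= ->.
  apply: RintegralZl; first exact: mlev.
  apply: (integrableS measurableT) => //; first exact: mlev.
  exact: integrable_normal_pdf.
Qed.

Let quad_cst1 : cst 1 = quad (0, 0, 1).
Proof. by apply/funext => r; rewrite /quad /=; ring. Qed.

Let quad_id : id = quad (0, 1, 0).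
Proof. by apply/funext => r; rewrite /quad /=; ring. Qed.

Let momE p k j : mom (quad p) k j =
  p.1.1 * mom (quad (1, 0, 0)) k j + p.1.2 * mom id k j + p.2 * mom (cst 1) k j.
Proof.
rewrite quad_cst1 quad_id /mom.
have mUl : measurable (U k @^-1` lev j).
  by rewrite -[X in measurable X]setTI; apply: mU => //; exact: mlev.
have qi p' : P.-integrable (U k @^-1` lev j) (EFin \o (quad p' \o U k)).
  exact: (integrableS measurableT).
have qZ (c : R) p' : P.-integrable (U k @^-1` lev j)
    (EFin \o (fun w => c * quad p' (U k w))).
  have -> : (fun w => c * quad p' (U k w)) =
      quad (c * p'.1.1, c * p'.1.2, c * p'.2) \o U k.
    by apply/funext => w; rewrite /quad /=; ring.
  exact: qi.
rewrite -!RintegralZl//; [|exact: qi..].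
have qD (c c' : R) p' p'' : P.-integrable (U k @^-1` lev j)
    (EFin \o (fun w => c * quad p' (U k w) + c' * quad p'' (U k w))).
  have -> : (fun w => c * quad p' (U k w) + c' * quad p'' (U k w)) =
      quad (c * p'.1.1 + c' * p''.1.1, c * p'.1.2 + c' * p''.1.2,
            c * p'.2 + c' * p''.2) \o U k.
    by apply/funext => w; rewrite /quad /=; ring.
  exact: qi.
rewrite -!RintegralD//.
by apply: eq_Rintegral => w _; rewrite /quad /=; ring.
Qed.

Let fZ_gt0 k : 0 < fZ b q (g k) (sigma k) (eta k) (z k).
Proof.
rewrite fZE.
have := @sum_mom1_gam_gt0 d Omega R P K a _ U q
  (fun j i => bitvec R (b j) i 0) (fun k i => z k i 0) eta.
move=> /(_ mlev (fun k => lt0r_neq0 (eta0 k)) mU k).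
congr (0 < _); apply: eq_bigr => j _; congr (_ * _).
by rewrite /gam gauss_vec_pdfE.
Qed.

(** The summands of [Bcoef] are the posterior probabilities of the levels given the observation, by
    Bayes' rule. *)
Lemma Bcoef1 k : Bcoef tau b q (sigma k) (eta k) (z k) (g k) = 1.
Proof.
transitivity ((\sum_j mom (cst 1) k j * gam k j) /
  fZ b q (g k) (sigma k) (eta k) (z k)).
  rewrite mulr_suml; apply: eq_bigr => j _.
  by rewrite mom1E /gam /gauss_vec_pdf (invfM (fZ _ _ _ _ _ _)); ring.
by rewrite -fZE divff// lt0r_neq0.
Qed.

Let AcoefE k : Acoef tau b q (sigma k) (eta k) (z k) (g k) =
  (\sum_j mom id k j * gam k j) / fZ b q (g k) (sigma k) (eta k) (z k).
Proof.
rewrite /Acoef mulr_suml; apply: eq_bigr => j _.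
have -> : mom id k j =
    \int[lebesgue_measure]_(r in lev j) (r * normal_pdf (g k) (sigma k) r).
  exact: (@Rintegral_normal_law _ _ _ _ _ _ _ (mU k) (@hU k) (lev j) id).
rewrite (Rintegral_level_id_normal_pdf (g k) j htau hq (sigma0 k)).
by rewrite /gam /gauss_vec_pdf (invfM (fZ _ _ _ _ _ _)); ring.
Qed.

(** Here [E2 k] is the conditional mean of the square of [U k]. It is chosen before the coefficients
    [p], hence is the same for all theta when [p] later depends on theta. *)
Lemma cvg_cond_mean_near_quad : exists E2 : 'I_K -> R,
  forall p : 'I_K -> R * R * R,
  P.-integrable setT (EFin \o (fun w => \sum_k quad (p k) (U k w))) /\
  cond_mean_near P (fun w => \sum_k quad (p k) (U k w)) Z zobs e @[e --> 0^'+] -->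
  \sum_k ((p k).1.1 * E2 k +
          (p k).1.2 * Acoef tau b q (sigma k) (eta k) (z k) (g k) + (p k).2).
Proof.
exists (fun k => (\sum_j mom (quad (1, 0, 0)) k j * gam k j) /
  fZ b q (g k) (sigma k) (eta k) (z k)) => p.
apply: (@cvg_cond_mean_near_sum d Omega R P _ Z zobs _ (fun k w => quad (p k) (U k w))).
- move=> e; exact: (@measurable_near_event d Omega R K a _ U N q
    (fun j i => bitvec R (b j) i 0) (fun k i => z k i 0) mlev mU mN e).
- by move=> k; exact: integrable_quad.
- move=> k.
  have eta0' i : eta i != 0 by rewrite gt_eqF.
  have lim := @cvg_cond_mean_near d Omega R P K a _ U N q
    (fun j i => bitvec R (b j) i 0) (fun k i => z k i 0) eta mlev eta0' mU mN hN hV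
    (quad (p k)) k (measurable_quad (p k)) (integrable_quad (p k) k).
  (* The constant coefficient survives unchanged because its moment sum is [fZ] itself. *)
  rewrite (_ : _ + _ = (\sum_j mom (quad (p k)) k j * gam k j) /
      fZ b q (g k) (sigma k) (eta k) (z k)); last first.
    have -> : \sum_j mom (quad (p k)) k j * gam k j =
        (p k).1.1 * (\sum_j mom (quad (1, 0, 0)) k j * gam k j) +
        (p k).1.2 * (\sum_j mom id k j * gam k j) +
        (p k).2 * (\sum_j mom (cst 1) k j * gam k j).
      rewrite !mulr_sumr -!big_split/=; apply: eq_bigr => j _.
      by rewrite momE; ring.
    rewrite -fZE AcoefE; field.
    by rewrite gt_eqF// fZ_gt0.
  rewrite fZE.
  have eq1 h : \sum_j mom h k j * gam k j = \sum_j mom h k j *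
      \prod_(i < a) normal_pdf 0 (eta k) (z k i 0 - bitvec R (b j) i 0).
    by apply: eq_bigr => j _; rewrite /gam gauss_vec_pdfE.
  by rewrite (eq1 (quad (p k))) (eq1 (cst 1)); exact: lim.
Qed.

End em_moments.

(** * The maximization step *)

Theorem lemma3p1 (R : realType)
  (d : measure_display) (Omega : measurableType d) (P : probability Omega R)
  (K L alpha : nat) (hK : (1 <= K)%N) (hL : (1 <= L)%N) (halpha : (1 <= alpha)%N)
  (Theta : set 'rV[R]_L)
  (G : R -> R -> 'rV[R]_L -> R)
  (hG : forall (u v : R) (theta : 'rV[R]_L), Theta theta ->
     differentiable (G u v) theta)
  (x y : 'I_K -> R)
  (sigma eta : 'I_K -> R)
  (hsigma : forall k, 0 < sigma k) (heta : forall k, 0 < eta k)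
  (tau : nat -> \bar R) (htau : quantizer_boundaries (2 ^ alpha) tau)
  (q : R -> 'I_(2 ^ alpha)) (hq : quantizes tau q)
  (b : 'I_(2 ^ alpha) -> alpha.-tuple bool) (hb : injective b)
  (W : 'I_K -> {RV P >-> R}) (N : 'I_K -> 'I_alpha -> {RV P >-> R})
  (hW : forall k, has_normal_law P (W k) 0 (sigma k))
  (hN : forall k i, has_normal_law P (N k i) 0 (eta k))
  (hind : mutually_independent P
     (fun c : 'I_K + 'I_K * 'I_alpha =>
        match c with
        | inl k => W k : Omega -> R
        | inr (k, i) => N k i : Omega -> R
        end))
  (* the observed values, the current estimate and the next one *)
  (z : 'I_K -> 'cV[R]_alpha)
  (theta_m theta_m1 : 'rV[R]_L)
  (htheta_m : Theta theta_m) (htheta_m1 : Theta theta_m1) :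
  let Gk := fun (k : 'I_K) (theta : 'rV[R]_L) => G (x k) (y k) theta in
  let Rk := fun (k : 'I_K) (w : Omega) => Gk k theta_m + W k w in
  let Z := fun (c : 'I_K * 'I_alpha) (w : Omega) =>
    bitvec R (b (q (Rk c.1 w))) c.2 0 + N c.1 c.2 w in
  let zobs := fun c : 'I_K * 'I_alpha => z c.1 c.2 0 in
  let loglik := fun (theta : 'rV[R]_L) (w : Omega) =>
    - (1 / 2) * \sum_(k < K) (Rk k w - Gk k theta) ^+ 2 / sigma k ^+ 2 in
  let T := fun theta : 'rV[R]_L => cond_exp_at P (loglik theta) Z zobs in
  let score := fun (t : 'I_L) (w : Omega) =>
    \sum_(k < K) (Rk k w - Gk k theta_m1) / sigma k ^+ 2 *
                 partial (Gk k) t theta_m1 in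
  let A := fun k : 'I_K =>
    Acoef tau b q (sigma k) (eta k) (z k) (Gk k theta_m) in
  let B := fun k : 'I_K =>
    Bcoef tau b q (sigma k) (eta k) (z k) (Gk k theta_m) in
  [/\ (* the quantities in the maximization step exist and agree *)
      (forall theta, has_cond_exp_at P (loglik theta) Z zobs) /\
      (forall t : 'I_L,
        [/\ has_cond_exp_at P (score t) Z zobs,
            derivable T theta_m1 (delta_mx 0 t) &
            partial T t theta_m1 = cond_exp_at P (score t) Z zobs]),
      (* the maximization step, for arbitrary sigma_k *)
      (forall t : 'I_L,
        partial T t theta_m1 = 0 <->
        \sum_(k < K) (sigma k ^+ 2)^-1 * partial (Gk k) t theta_m1 * A k
        - \sum_(k < K) (sigma k ^+ 2)^-1 * Gk k theta_m1 *
                       partial (Gk k) t theta_m1 * B k = 0) &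
      (* the maximization step, for sigma_k not depending on k *)
      (forall k l : 'I_K, sigma k = sigma l) ->
      forall t : 'I_L,
        partial T t theta_m1 = 0 <->
        \sum_(k < K) partial (Gk k) t theta_m1 * A k
        - \sum_(k < K) Gk k theta_m1 * partial (Gk k) t theta_m1 * B k = 0].

Proof.
move=> Gk Rk Z zobs loglik T score A B.
have mR k : measurable_fun setT (Rk k) by exact: measurable_funD.
have hR k : has_normal_law P (Rk k) (Gk k theta_m) (sigma k).
  by apply: normal_law_shift; [rewrite gt_eqF|exact: hW].
have hV : mutually_independent P (fun c : 'I_K + 'I_K * 'I_alpha =>
    match c with inl k => Rk k | inr ki => N ki.1 ki.2 : Omega -> R end).
  (* Passing from [W k] to [Rk k] is a deterministic translation of each variable, which preserves
     independence. *)
  pose f (c : 'I_K + 'I_K * 'I_alpha) (r : R) : R :=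
    match c with inl k => Gk k theta_m + r | inr _ => r end.
  have mf c : measurable_fun setT (f c).
    by case: c => [k|ki]; [exact: measurable_funD|exact: measurable_id].
  have := mutually_independent_comp mf hind.
  by congr mutually_independent; apply/funext => -[k|[k i]].
have mN k i : measurable_fun setT (N k i) by exact: measurable_funPT.
have [E2 cvg_quad] := cvg_cond_mean_near_quad b z hsigma heta htau hq mR mN hR hN hV.
have B1 k : B k = 1.
  exact: (Bcoef1 b z hsigma heta htau hq mR hR).
have s0 k : sigma k != 0 by rewrite gt_eqF.
have sn0 k : sigma k ^+ 2 != 0 by rewrite expf_neq0.
have quad_cond (X : Omega -> R) (p : 'I_K -> R * R * R) :
    (forall w, X w = \sum_k ((p k).1.1 * Rk k w ^+ 2 + (p k).1.2 * Rk k w + (p k).2)) ->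
    has_cond_exp_at P X Z zobs /\
    cond_exp_at P X Z zobs = \sum_k ((p k).1.1 * E2 k + (p k).1.2 * A k + (p k).2).
  move=> XE; have -> : X = fun w =>
      \sum_k ((p k).1.1 * Rk k w ^+ 2 + (p k).1.2 * Rk k w + (p k).2).
    exact/funext.
  have [Xi Xc] := cvg_quad p; split; last exact: (cvg_lim _ Xc).
  by split => //; apply/cvg_ex; eexists; exact: Xc.
pose Dk k t := partial (Gk k) t theta_m1.
have loglikE theta : has_cond_exp_at P (loglik theta) Z zobs /\
    T theta = \sum_k (- (1 / 2) / sigma k ^+ 2 * E2 k
      + Gk k theta / sigma k ^+ 2 * A k - 1 / 2 * Gk k theta ^+ 2 / sigma k ^+ 2).
  (* Expanding the square leaves theta only in the linear and constant coefficients, so the [E2]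
     term of [T] has derivative 0. *)
  apply: (quad_cond _ (fun k => (- (1 / 2) / sigma k ^+ 2, Gk k theta / sigma k ^+ 2,
    - (1 / 2 * Gk k theta ^+ 2 / sigma k ^+ 2)))) => w.
  rewrite /loglik mulr_sumr; apply: eq_bigr => k _ /=.
  by field; exact: s0.
have scoreE t : has_cond_exp_at P (score t) Z zobs /\
    cond_exp_at P (score t) Z zobs =
    \sum_k (0 * E2 k + Dk k t / sigma k ^+ 2 * A k
      - Gk k theta_m1 * Dk k t / sigma k ^+ 2).
  apply: (quad_cond _ (fun k => (0, Dk k t / sigma k ^+ 2,
    - (Gk k theta_m1 * Dk k t / sigma k ^+ 2)))) => w.
  rewrite /score; apply: eq_bigr => k _ /=; rewrite -/(Dk k t).
  by field; exact: s0.
have dT t : is_derive theta_m1 (delta_mx 0 t) T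
    (\sum_k (Dk k t / sigma k ^+ 2 * A k - Gk k theta_m1 * Dk k t / sigma k ^+ 2)).
  have dG k : is_derive theta_m1 (delta_mx 0 t) (Gk k) (Dk k t).
    by apply: DeriveDef => //; apply: diff_derivable; exact: hG.
  (* Written as a combination of functions rather than of values, [T] can be differentiated by
     inference of [is_derive] instances. *)
  have -> : T = \sum_(k < K) (cst (- (1 / 2) / sigma k ^+ 2 * E2 k) +
      (A k / sigma k ^+ 2) \*: Gk k - (2 * sigma k ^+ 2)^-1 \*: (Gk k * Gk k)).
    apply/funext => theta; rewrite (loglikE theta).2 fct_sumE; apply: eq_bigr => k _.
    change (- (1 / 2) / sigma k ^+ 2 * E2 k + Gk k theta / sigma k ^+ 2 * A k
        - 1 / 2 * Gk k theta ^+ 2 / sigma k ^+ 2 =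
      - (1 / 2) / sigma k ^+ 2 * E2 k + A k / sigma k ^+ 2 * Gk k theta
        - (2 * sigma k ^+ 2)^-1 * (Gk k theta * Gk k theta)).
    by field; exact: s0.
  apply: is_derive_eq; apply: eq_bigr => k _.
  rewrite add0r /GRing.scale/=; field; exact: s0.
have partialT t : partial T t theta_m1 =
    \sum_k (Dk k t / sigma k ^+ 2 * A k - Gk k theta_m1 * Dk k t / sigma k ^+ 2).
  by have := dT t => h; rewrite /partial derive_val.
have partialTE t : partial T t theta_m1 =
    \sum_k (sigma k ^+ 2)^-1 * Dk k t * A k
    - \sum_k (sigma k ^+ 2)^-1 * Gk k theta_m1 * Dk k t * B k.
  rewrite partialT -sumrB; apply: eq_bigr => k _; rewrite B1; ring.
split.
- split=> [theta|t]; first exact: (loglikE theta).1.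
  split; [exact: (scoreE t).1|by have [] := dT t|].
  rewrite partialT (scoreE t).2; apply: eq_bigr => k _; ring.
- by move=> t; rewrite partialTE.
- move=> sigma_eq t; rewrite partialTE.
  (* [K] is positive, so a sensor exists to name the common deviation; its inverse square is a
     nonzero factor that cancels. *)
  pose k0 : 'I_K := Ordinal hK.
  have -> : \sum_k (sigma k ^+ 2)^-1 * Dk k t * A k
      - \sum_k (sigma k ^+ 2)^-1 * Gk k theta_m1 * Dk k t * B k =
    (sigma k0 ^+ 2)^-1 * (\sum_k Dk k t * A k - \sum_k Gk k theta_m1 * Dk k t * B k).
    rewrite mulrBr !mulr_sumr; congr (_ - _); apply: eq_bigr => k _;
    by rewrite (sigma_eq k k0) !mulrA.
  split=> [/eqP|->]; last by rewrite mulr0.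
  by rewrite mulf_eq0 invr_eq0 (negbTE (sn0 k0)) => /eqP.
Qed.
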